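(* For arbitrarily large $K$ (that is, for every $K_0$ there is some $K \geq K_0$) there exist a group $G$ and a finite $K$-approximate group $A \subset G$ with the following property: there is no subgroup $\Gamma \leq G$ such that $\Gamma$ has a finite normal subgroup $H$ with $\Gamma/H$ solvable and such that $A$ is covered by at most $K^{\log\log K}$ cosets of $\Gamma$.
   Context: A subset $A$ of a group $G$ is called a $K$-approximate group if $A^2 \subset XA$ for some set $X \subset G$ of size at most $K$, where $A^2=\{ab : a,b\in A\}$ and $XA=\{xa : x\in X, a\in A\}$. Cosets of $\Gamma$ are left cosets $g\Gamma$ with $g\in G$, so that $A$ being covered by at most $N$ cosets of $\Gamma$ means that $|A\Gamma/\Gamma| \leq N$, where $A\Gamma/\Gamma = \{a\Gamma : a \in A\}$. The symbol $\log$ denotes the natural logarithm. *)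

(* Defs.v *)
From HB Require Import structures.
From mathcomp Require Import all_boot all_order all_algebra.
From mathcomp Require Import generic_quotient finmap.
From mathcomp Require Import boolp classical_sets functions cardinality.
From mathcomp Require Import reals exp.

Set Implicit Arguments.
Unset Strict Implicit.
Unset Printing Implicit Defensive.

Import Order.TTheory GRing.Theory Num.Theory.
Local Open Scope classical_set_scope.
Local Open Scope quotient_scope.
Local Open Scope group_scope.

Definition is_subgroup (G : groupType) (S : set G) : Prop :=
  group_closed (fun x => x \in S).

Record subgroup (G : groupType) := Subgroup {
  subgroup_set :> set G;
  subgroupP : is_subgroup subgroup_set }.

Definition subgroup_type (G : groupType) (S : subgroup G) : Type := set_type S.

HB.instance Definition _ (G : groupType) (S : subgroup G) :=
  SubChoice.copy (subgroup_type S) (set_type S).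
HB.instance Definition _ (G : groupType) (S : subgroup G) :=
  SubChoice_isSubGroup.Build G _ (subgroup_type S) (@subgroupP G S).

Record normal_subgroup (G : groupType) := NormalSubgroup {
  normal_sub :> subgroup G;
  normal_subP : forall x y : G,
    subgroup_set normal_sub x -> subgroup_set normal_sub (x ^ y) }.

Section SubgroupTheory.
Variables (G : groupType) (S : subgroup G).

Lemma subgroup1 : subgroup_set S 1.
Proof. by have [/set_mem] := @subgroupP G S. Qed.

Lemma subgroupF x y :
  subgroup_set S x -> subgroup_set S y -> subgroup_set S (x / y).
Proof.
by have [_ SF] := @subgroupP G S => Sx Sy; apply/set_mem/SF; apply/mem_set.
Qed.

Lemma subgroupV x : subgroup_set S x -> subgroup_set S x^-1.
Proof. by move=> Sx; rewrite -[x^-1]mul1g; apply: subgroupF subgroup1 Sx. Qed.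

Lemma subgroupM x y :
  subgroup_set S x -> subgroup_set S y -> subgroup_set S (x * y).
Proof. by move=> Sx Sy; rewrite -[y]invgK; apply/subgroupF/subgroupV. Qed.

End SubgroupTheory.

Section Quotient.
Variables (G : groupType) (H : normal_subgroup G).

(* x H = y H *)
Definition same_coset (x y : G) : bool := (x^-1 * y) \in subgroup_set H.

Lemma same_coset_refl : reflexive same_coset.
Proof. by move=> x; rewrite /same_coset mulVg mem_set //; apply: subgroup1. Qed.

Lemma same_coset_sym : symmetric same_coset.
Proof.
suff h x y : same_coset x y -> same_coset y x.
  by move=> x y; apply/idP/idP; apply: h.
move=> /set_mem/subgroupV; rewrite invgM invgK => h; exact: mem_set.
Qed.

Lemma same_coset_trans : transitive same_coset.
Proof.
move=> y x z /set_mem Hxy /set_mem Hyz; apply: mem_set.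
by have := subgroupM Hxy Hyz; rewrite mulgA mulgK.
Qed.

Canonical same_coset_equiv :=
  EquivRel same_coset same_coset_refl same_coset_sym same_coset_trans.

Definition quotient_group : Type := {eq_quot same_coset_equiv}.

HB.instance Definition _ :=
  Choice.copy quotient_group {eq_quot same_coset_equiv}.

Definition quotient_proj (x : G) : quotient_group :=
  \pi_{eq_quot same_coset_equiv} x.

Definition quotient_repr (u : quotient_group) : G :=
  repr (u : {eq_quot same_coset_equiv}).

Lemma quotient_reprK u : quotient_proj (quotient_repr u) = u.
Proof. exact: reprK. Qed.

Lemma quotient_proj_eq x y : quotient_proj x = quotient_proj y <->
  subgroup_set H (x^-1 * y).
Proof.
split=> [/eqmodP/set_mem // | Hxy]; apply/eqmodP.
exact: mem_set.
Qed.

Definition quotient_mul (u v : quotient_group) : quotient_group :=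
  quotient_proj (quotient_repr u * quotient_repr v).
Definition quotient_inv (u : quotient_group) : quotient_group :=
  quotient_proj (quotient_repr u)^-1.

Lemma quotient_proj_mul x y : quotient_mul (quotient_proj x) (quotient_proj y) =
  quotient_proj (x * y).
Proof.
apply/quotient_proj_eq; set x' := quotient_repr _; set y' := quotient_repr _.
have Hx : subgroup_set H (x'^-1 * x)
  by apply/quotient_proj_eq; exact: quotient_reprK.
have Hy : subgroup_set H (y'^-1 * y)
  by apply/quotient_proj_eq; exact: quotient_reprK.
have -> : (x' * y')^-1 * (x * y) = (y'^-1 * y) * (x'^-1 * x) ^ y.
  by rewrite conjgE invgM !mulgA mulgK.
exact/subgroupM/normal_subP.
Qed.

Lemma quotient_proj_inv x : quotient_inv (quotient_proj x) = quotient_proj x^-1.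
Proof.
apply/quotient_proj_eq; set x' := quotient_repr _; rewrite invgK.
have Hx : subgroup_set H (x'^-1 * x)
  by apply/quotient_proj_eq; exact: quotient_reprK.
have -> : x' / x = ((x'^-1 * x) ^ x^-1)^-1.
  by rewrite conjgE invgK mulgK invgM invgK.
exact/subgroupV/normal_subP.
Qed.

Lemma quotient_mulA : associative quotient_mul.
Proof.
move=> u v w; rewrite -[u]quotient_reprK -[v]quotient_reprK -[w]quotient_reprK.
by rewrite !quotient_proj_mul mulgA.
Qed.

Lemma quotient_mul1 : left_id (quotient_proj 1) quotient_mul.
Proof. by move=> u; rewrite -[u]quotient_reprK quotient_proj_mul mul1g. Qed.

Lemma quotient_mulr1 : right_id (quotient_proj 1) quotient_mul.
Proof. by move=> u; rewrite -[u]quotient_reprK quotient_proj_mul mulg1. Qed.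

Lemma quotient_mulV : left_inverse (quotient_proj 1) quotient_inv quotient_mul.
Proof.
by move=> u; rewrite -[u]quotient_reprK quotient_proj_inv quotient_proj_mul
  mulVg.
Qed.

Lemma quotient_mulrV :
  right_inverse (quotient_proj 1) quotient_inv quotient_mul.
Proof.
by move=> u; rewrite -[u]quotient_reprK quotient_proj_inv quotient_proj_mul
  mulgV.
Qed.

HB.instance Definition _ := isGroup.Build quotient_group
  quotient_mulA quotient_mul1 quotient_mulr1 quotient_mulV quotient_mulrV.

Lemma quotient_projM : {morph quotient_proj : x y / x * y}.
Proof. by move=> x y; rewrite -quotient_proj_mul. Qed.

End Quotient.

Definition generated_subgroup (G : groupType) (S : set G) : set G :=
  smallest (@is_subgroup G) S.

Section Solvable.
Variable G : groupType.

Fixpoint derived_series (n : nat) : set G :=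
  if n is m.+1 then
    generated_subgroup
      [set [~ x, y] | x in derived_series m & y in derived_series m]
  else [set: G].

Definition solvable_group : Prop := exists n, derived_series n = [set 1].

End Solvable.

Definition set_mulg (G : groupType) (A B : set G) : set G :=
  [set a * b | a in A & b in B].

Definition approximate_group (R : realType) (K : R) (G : groupType)
    (A : set G) : Prop :=
  exists X : {fset G}, (#|` X|%:R <= K)%R /\
    set_mulg A A `<=` set_mulg [set` X] A.

Definition left_coset (G : groupType) (S : set G) (g : G) : set G :=
  [set g * s | s in S].

Definition left_cosets (G : groupType) (A : {fset G}) (S : subgroup G) :
    {fset set G} :=
  [fset left_coset S a | a in A]%fset.

(* Main.v *)
(* Let G be the wreath product of the symmetric group S_n with Z, let A be
   S_n times the box {0, ..., L}^n, and let K = 2^n; then A is K-approximate,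
   as {0, ..., 2L}^n is a union of 2^n translates of {0, ..., L}^n.  If Gamma
   covers A in at most L cosets then it contains a nonzero multiple of each
   basis vector of Z^n; since an element with nontrivial permutation part has
   infinitely many conjugates under these, a finite normal subgroup of Gamma
   lies in Z^n.  Hence, if Gamma is finite-by-solvable, its image P in S_n is
   solvable, so that |P| <= 16^(n-1), and A meets at least
   n! / |P| >= (n / 64)^n cosets of Gamma.  This exceeds
   K^(log log K) <= n^(n log 2) for large n, because log 2 < 1. *)
From HB Require Import structures.
From mathcomp Require Import all_boot all_order all_algebra.
From mathcomp Require Import all_fingroup all_solvable zify lra.
Set Implicit Arguments.
Unset Strict Implicit.
Unset Printing Implicit Defensive.
Import Order.TTheory GRing.Theory Num.Theory.

(** * Orders of solvable permutation groups *)

Section SolvableActions.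
Local Open Scope group_scope.

Lemma indexg_stab_le (gT : finGroupType) (T : finType)
    (to : {action gT &-> T}) (G : {group gT}) (S : {set T}) (x : T) :
  [acts G, on S | to] -> x \in S -> #|G : 'C_G[x | to]| <= #|S|.
Proof.
move=> actsG xS; rewrite -card_orbit; apply: subset_leq_card.
by rewrite acts_sub_orbit.
Qed.

(** The sets are fixed pointwise one after another, and the indices along the resulting chain of
    stabilisers multiply. The bound [f B] is asked of every subgroup [D] because the later links
    start from a smaller group. *)
Lemma indexg_astab_bigcup (gT : finGroupType) (T : finType)
    (to : {action gT &-> T}) (r : seq {set T}) (f : {set T} -> nat)
    (G : {group gT}) :
    (forall (D : {group gT}) B, D \subset G -> B \in r ->
       #|D : 'C_D(B | to)| <= f B) ->
  #|G : 'C_G(\bigcup_(B <- r) B | to)| <= \prod_(B <- r) f B.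
Proof.
elim: r G => [|B r IHr] G fG.
  rewrite !big_nil (_ : 'C_G(_ | to) = G) ?indexgg //.
  by apply/setIidPl/subsetP => g _; apply/astabP => x; rewrite inE.
rewrite !big_cons astabU setIA.
rewrite -(@Lagrange_index _ G ('C_G(B | to))%G) ?subsetIl //= mulnC.
rewrite mulnC; apply: leq_mul; first by apply: fG; rewrite ?mem_head.
apply: IHr => D C sD rC; apply: fG; first exact/(subset_trans sD)/subsetIl.
by rewrite inE rC orbT.
Qed.

Section TransitiveAbelian.

Variables (gT : finGroupType) (T : finType) (to : {action gT &-> T}).
Variables (G N : {group gT}) (S : {set T}).
Hypotheses (actsG : [acts G, on S | to]) (nNG : G \subset 'N(N)).
Hypotheses (abN : [~: N, N] \subset 'C(S | to)).
Hypothesis (trN : [transitive N, on S | to]).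

(* [N] acts on [S] as a transitive abelian group, hence regularly. *)
Lemma transitive_abelian_free z w g :
  z \in S -> w \in S -> g \in N -> to z g = z -> to w g = w.
Proof.
move=> zS wS gN zg; have [n nN ->] := atransP2 trN zS wS.
have /astabP cng : [~ n, g] \in 'C(S | to) by apply/(subsetP abN)/mem_commg.
rewrite -actM commgC actM [to z _]actM zg cng //.
by rewrite (acts_act (atrans_acts trN)).
Qed.

(** If [m] in [N] carries [x] to [y], then [m] carries the fixed points of [D] to fixed points of
    the stabiliser of [y] in [D]. None of these images is fixed by [D], since otherwise freeness
    would make [y] fixed as well. *)
Lemma card_fix_double (D : {group gT}) x y :
    D \subset G -> x \in S -> y \in S ->
    x \in 'Fix_(S | to)(D) -> y \notin 'Fix_(S | to)(D) ->
  #|'Fix_(S | to)(D)|.*2 <= #|'Fix_(S | to)('C_D[y | to])|.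
Proof.
move=> sDG xS yS xF yF; have [m mN ym] := atransP2 trN xS yS.
have fixP (E : {set gT}) z : reflect (z \in S /\ {in E, forall d, to z d = z})
    (z \in 'Fix_(S | to)(E)).
  by rewrite inE; apply: (iffP andP) => -[zS /afixP].
have mS z : z \in S -> to z m \in S.
  by move=> zS; rewrite (acts_act (atrans_acts trN)).
have mdN d : d \in D -> m ^ d * m^-1 \in N.
  move=> dD; rewrite groupM ?groupV // memJ_norm //.
  exact/(subsetP nNG)/(subsetP sDG).
(* For [z] fixed by [d], [z m] is fixed by [d] iff [m ^ d / m] fixes [z],
   a condition which does not depend on [z]. *)
have mfix z d : to z d = z ->
    (to (to z m) d = to z m) <-> (to z (m ^ d * m^-1) = z).
  move=> zd; rewrite -actM conjgC actM zd (actM to z (m ^ d) m^-1).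
  by split=> [->|h]; [rewrite actK | rewrite -[LHS](actKV to m) h].
have [_ xD] := fixP _ _ xF.
have mfixF z d : d \in 'C_D[y | to] -> z \in 'Fix_(S | to)(D) ->
    to (to z m) d = to z m.
  case/setIP=> dD /astab1P yd /fixP[zS zD].
  apply/mfix; first exact: zD.
  apply: (transitive_abelian_free xS zS (mdN _ dD)).
  by apply/mfix; [apply: xD | rewrite -ym yd].
have im_card : #|[set to z m | z in 'Fix_(S | to)(D)]| = #|'Fix_(S | to)(D)|.
  by apply: card_in_imset => ? ? _ _; apply: act_inj.
have disj : 'Fix_(S | to)(D) :&: [set to z m | z in 'Fix_(S | to)(D)] = set0.
  apply/setP=> w; rewrite in_set0; apply: contraNF yF.
  case/setIP=> /fixP[wS wD] /imsetP[z zF wE]; have [zS zD] := fixP _ _ zF.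
  apply/fixP; split=> // d dD; rewrite ym; apply/mfix; first exact: xD.
  apply: (transitive_abelian_free zS xS (mdN _ dD)).
  by apply/mfix; [apply: zD | rewrite -wE wD].
rewrite -addnn -{2}im_card -cardsUI disj cards0 addn0.
apply/subset_leq_card/subsetP => w /setUP[/fixP[wS wD]|/imsetP[z zF ->]].
  by apply/fixP; split=> // d /setIP[/wD].
have [zS _] := fixP _ _ zF.
by apply/fixP; split=> [|d dD]; [apply: mS | apply: mfixF].
Qed.

(** Stabilising one more point costs a factor of at most [#|S|] and at least doubles the fixed set,
    so everything is fixed after at most [k] rounds. *)
Lemma index_stab_fix k (D : {group gT}) x :
    D \subset G -> x \in 'Fix_(S | to)(D) ->
    #|S| < 2 ^ k.+1 * #|'Fix_(S | to)(D)| ->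
  #|D : 'C_D(S | to)| <= #|S| ^ k.
Proof.
elim: k D => [|k IHk] D sDG xF ltS.
all: have xS : x \in S by case/setIP: xF.
all: have S0 : 0 < #|S| by apply/card_gt0P; exists x.
all: have [sSF|/subsetPn[y yS yF]] := boolP (S \subset 'Fix_(S | to)(D)).
1,3: rewrite (_ : 'C_D(S | to) = D) ?indexgg ?expn_gt0 ?S0 //.
1,2: by apply/setIidPl; rewrite astabC (subset_trans sSF) ?subsetIr.
all: have dbl := card_fix_double sDG xS yS xF yF.
  (* For [k = 0] more than half of [S] is already fixed, so doubling is impossible. *)
  have := subset_leq_card (subsetIl S 'Fix_to('C_D[y | to])).
  by move: ltS dbl; rewrite expn1; lia.
have sCS : 'C_D(S | to) \subset 'C_D[y | to].
  by apply: setIS; apply: astabS; rewrite sub1set.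
rewrite -(@Lagrange_index _ D ('C_D[y | to])%G ('C_D(S | to))%G) ?subsetIl //=.
rewrite expnS; apply: leq_mul.
  by apply: indexg_stab_le yS; exact: subset_trans sDG actsG.
have -> : 'C_D(S | to) = 'C_('C_D[y | to])(S | to).
  rewrite -setIA; congr (_ :&: _); apply/esym/setIidPr.
  by apply: astabS; rewrite sub1set.
apply: IHk; first exact/(subset_trans _ sDG)/subsetIl.
  move: xF => /setIP[_ /afixP xD]; rewrite inE xS.
  by apply/afixP => d /setIP[/xD].
by apply: leq_trans ltS _; rewrite expnSr -mulnA leq_mul2l mul2n dbl orbT.
Qed.

(** The stabiliser of a point has index at most [#|S|] and a nonempty fixed set, which leaves room
    for at most [trunc_log 2 #|S|] doublings. *)
Lemma index_transitive_abelian :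
  #|G : 'C_G(S | to)| <= #|S| ^ (trunc_log 2 #|S|).+1.
Proof.
have [x xS] : exists x, x \in S by case/imsetP: trN => x xS _; exists x.
have S0 : 0 < #|S| by apply/card_gt0P; exists x.
have sCS : 'C_G(S | to) \subset 'C_G[x | to].
  by apply: setIS; apply: astabS; rewrite sub1set.
rewrite -(@Lagrange_index _ G ('C_G[x | to])%G ('C_G(S | to))%G) ?subsetIl //=.
rewrite expnS; apply: leq_mul; first exact: indexg_stab_le xS.
have -> : 'C_G(S | to) = 'C_('C_G[x | to])(S | to).
  rewrite -setIA; congr (_ :&: _); apply/esym/setIidPr.
  by apply: astabS; rewrite sub1set.
have xF : x \in 'Fix_(S | to)('C_G[x | to]).
  by rewrite inE xS; apply/afixP => d /setIP[_ /astab1P].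
apply: (@index_stab_fix _ _ x); rewrite ?subsetIl //.
have F0 : 0 < #|'Fix_(S | to)('C_G[x | to])| by apply/card_gt0P; exists x.
by apply: leq_trans (trunc_log_ltn _ _) (leq_pmulr _ F0).
Qed.

End TransitiveAbelian.

Lemma trunc_log_exp_bound n : 1 < n -> n ^ (trunc_log 2 n).+1 <= 16 ^ n.-1.
Proof.
move=> n1; set k := trunc_log 2 n.
have k1 : 0 < k by rewrite trunc_log_gt0.
have lek : 2 ^ k <= n by apply: trunc_logP; lia.
have ltk : n <= 2 ^ k.+1 by apply/ltnW/trunc_log_ltn.
(* As [n <= 2 ^ k.+1], it suffices that [(k + 1)^2 <= 4 (n - 1)]. Equality holds for [n = 2], whence
   the base [16 = 2 ^ 4]. *)
have sq : forall j, 0 < j -> j.+1 ^ 2 + 4 <= 4 * 2 ^ j.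
  elim=> // -[|[|j]] IHj _ //; have := IHj isT; rewrite !expnS !expn0; nia.
have sqk : k.+1 * k.+1 <= 4 * n.-1 by have := sq k k1; lia.
apply: (@leq_trans ((2 ^ k.+1) ^ k.+1)%N); first by rewrite leq_exp2r.
by rewrite -expnM (_ : 16 = (2 ^ 4)%N) // -expnM leq_exp2l.
Qed.

(* The orbits of [N], the last term of the derived series acting nontrivially,
   form a block system; if [N] is transitive then it is regular. *)
Lemma solvable_action_index (gT : finGroupType) (T : finType)
    (to : {action gT &-> T}) (G : {group gT}) (S : {set T}) :
    solvable G -> [acts G, on S | to] ->
  #|G : 'C_G(S | to)| <= 16 ^ #|S|.-1.
Proof.
(* The induction ranges over all types and actions, because it is also applied to the action on the
   set of blocks. *)
have [m] := ubnP #|S|; elim: m => // m IHm in gT T to G S *.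
rewrite ltnS => leSm solG actsG.
have /ex_minnP[k sGkC mink] : exists k, G^`(k) \subset 'C(S | to).
  by have /derivedP[k Gk1] := solG; exists k; rewrite /= Gk1 sub1G.
case: k => [|k] in sGkC mink; first by rewrite (setIidPl sGkC) indexgg expn_gt0.
set N := (G^`(k))%G; have nNG : G \subset 'N(N) by apply: der_norm.
have sNG : N \subset G by apply: der_sub.
have actsN : [acts N, on S | to] := subset_trans sNG actsG.
have /subsetPn[n nN nC] : ~~ (N \subset 'C(S | to)).
  by apply/negP => /mink; rewrite ltnn.
have [x xS xn] : exists2 x, x \in S & to x n != x.
  apply/exists_inP; apply: contraR nC => /exists_inPn h.
  by apply/astabP => x /h /negPn/eqP.
pose P := orbit to N @: S; have partP : partition P S by apply: orbit_partition.
have ltPS : #|P| < #|S|.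
  rewrite ltn_neqAle leq_imset_card andbT; apply: contra xn => /imset_injP inj.
  apply/eqP/inj => //; first by rewrite (acts_act actsN).
  by apply/eqP; rewrite orbit_eq_mem mem_orbit.
(* This makes the exponents add up: [#|S|.-1] is [#|P|.-1] for the action on the blocks plus all the
   [#|B|.-1] for the actions inside them. *)
have PS : \sum_(B in P) #|B|.-1 + #|P| = #|S|.
  rewrite (card_partition partP) -sum1_card -big_split /=.
  apply: eq_bigr => B BP; rewrite addn1 prednK // card_gt0.
  exact: partition_neq0 partP BP.
have P0 : 0 < #|P| by apply/card_gt0P; exists (orbit to N x); apply: imset_f.
have [P1|P1] := leqP #|P| 1.
  have /cards1P[B PB] : #|P| == 1%N by rewrite eqn_leq P1.
  have SB : S = B by rewrite -(cover_partition partP) PB /cover big_set1.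
  have trN : [transitive N, on S | to].
    by rewrite /atrans -/P PB SB set11.
  apply: leq_trans (index_transitive_abelian actsG nNG sGkC trN) _.
  by apply: trunc_log_exp_bound; apply: leq_ltn_trans ltPS.
have actsP : [acts G, on P | to^*].
  apply/subsetP=> g gG; rewrite !inE; apply/subsetP=> B /imsetP[y yS ->].
  rewrite inE; suff: to^* (orbit to N y) g \in P by [].
  rewrite (setact_orbit to N y g) (normP (subsetP nNG g gG)) imset_f //.
  by rewrite (acts_act actsG).
have idxP : #|G : 'C_G(P | to^*)| <= 16 ^ #|P|.-1.
  by apply: IHm => //; apply: leq_trans leSm.
have sG1 : 'C_G(P | to^*) \subset G by apply: subsetIl.
apply: (@leq_trans #|G : 'C_('C_G(P | to^*))(S | to)|).
  by rewrite dvdn_leq ?indexg_gt0 //; apply: indexgS; apply: setSI.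
rewrite -(@Lagrange_index _ G ('C_G(P | to^*))%G) ?subsetIl //.
have -> : #|S|.-1 = #|P|.-1 + \sum_(B in P) #|B|.-1 
  by rewrite -PS; case: #|P| P0 => // p _; rewrite addnS addnC.
rewrite expnD; apply: leq_mul => //.
have coverS : \bigcup_(B <- enum P) B = S.
  by rewrite big_enum; apply: cover_partition partP.
rewrite expn_sum -big_enum /=.
have := @indexg_astab_bigcup _ _ to (enum P) (fun B => 16 ^ #|B|.-1)%N
  ('C_G(P | to^*))%G.
rewrite coverS; apply=> D B sD.
rewrite mem_enum => BP; apply: IHm.
(* There are at least two blocks, so each one is smaller than [S]. *)
- apply: leq_trans leSm; move: PS P1; rewrite (bigD1 B) //=.
  by move: (\sum_(_ in _ | _) _) #|P| #|S| #|B| => s p t b; clear; lia.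
- exact/(solvableS _ solG)/(subset_trans sD).
(* [D] lies in the kernel of the action on the blocks, so it preserves [B]. *)
apply: subset_trans sD _; apply: subset_trans (subsetIr _ _) _.
by rewrite -astab1_set; apply: astabS; rewrite sub1set.
Qed.

Lemma solvable_perm_card n (G : {group {perm 'I_n}}) :
  solvable G -> #|G| <= 16 ^ n.-1.
Proof.
move=> solG; have := @solvable_action_index _ _ 'P G [set: 'I_n] solG.
rewrite cardsT card_ord (_ : 'C_G(_ | _) = 1) ?indexg1; first apply.
  by apply/subsetP => g _; rewrite !inE; apply/subsetP => y; rewrite !inE.
apply/trivgP/subsetP => g /setIP[_ /astabP gfix].
by rewrite inE; apply/eqP/permP => y; rewrite perm1; apply: gfix.
Qed.

End SolvableActions.

(* Imported only here because [quotient_group] and the names of [finset]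
   lemmas would clash with those used above. *)
Require Import Defs.
From mathcomp Require Import finmap.
From mathcomp Require Import boolp classical_sets functions cardinality.
From mathcomp Require Import reals sequences exp.

(** * Derived series under homomorphisms *)

Section DerivedSeries.
Local Open Scope classical_set_scope.
Local Open Scope group_scope.

Lemma derived_series_subgroup (G : groupType) k :
  is_subgroup (@derived_series G k).
Proof.
case: k => [|k]; first by split=> [|x y _ _]; apply: mem_set.
split=> [|x y]; first by apply/mem_set => S [[S1 _] _]; apply: set_mem.
move=> /set_mem xd /set_mem yd; apply/mem_set => S SP.
have [[_ SF] _] := SP; apply/set_mem/SF; apply/mem_set; [exact: xd|exact: yd].
Qed.

Definition derived_subgroup (G : groupType) k :=
  Subgroup (@derived_series_subgroup G k).

(** The elements with such a lift form a group containing the required commutators. Solvability thus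
    passes from [G'] to [P] without a homomorphism between the two having to be built. *)
Lemma derived_series_lift (gT : finGroupType) (P : {group gT})
    (G G' : groupType) (f : UMagmaMorphism.type G gT)
    (g : UMagmaMorphism.type G G') k s :
    (forall s, s \in P -> exists x, f x = s) ->
  s \in P^`(k) -> exists x, f x = s /\ derived_series k (g x).
Proof.
move=> Pf; elim: k s => [|k IHk] s; first by move=> /Pf[x <-]; exists x.
pose Q :=
  [set s | `[< exists x, f x = s /\ @derived_series G' k.+1 (g x) >]]%SET.
have QP t : reflect
    (exists x, f x = t /\ @derived_series G' k.+1 (g x)) (t \in Q).
  by rewrite inE; apply: asboolP.
have Qgroup : group_set Q.
  apply/group_setP; split=> [|x y /QP[a [<- da]] /QP[b [<- db]]]; apply/QP.
    exists 1; rewrite !gmulf1; split=> //.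
    exact: (subgroup1 (derived_subgroup G' k.+1)).
  exists (a * b); rewrite !gmulfM; split=> //.
  exact: (subgroupM (S := derived_subgroup G' k.+1)).
suff: P^`(k.+1) \subset Group Qgroup.
  by move=> /fintype.subsetP h /h /QP.
rewrite dergSn gen_subG; apply/fintype.subsetP.
move=> _ /imset2P[x y /IHk[a [<- da]] /IHk[b [<- db]] ->].
apply/QP; exists [~ a, b]; rewrite !gmulfR; split=> //.
apply: sub_gen_smallest => /=.
by exists (g a) => //; exists (g b).
Qed.

Lemma quotient_projF (G : groupType) (H : normal_subgroup G) :
  {morph @quotient_proj G H : x y / x * y^-1}.
Proof. by move=> x y; rewrite quotient_projM -quotient_proj_inv. Qed.

HB.instance Definition _ (G : groupType) (H : normal_subgroup G) :=
  isGroupMorphism.Build G (quotient_group H) (@quotient_proj G H)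
    (@quotient_projF G H).

End DerivedSeries.

(** * The wreath product of the symmetric group with the integers *)

Section Wreath.
Variable n : nat.
Local Open Scope ring_scope.

Definition wreath : Type := {perm 'I_n} * {ffun 'I_n -> int}.
HB.instance Definition _ := Choice.on wreath.

Definition wreath_one : wreath := (1%g, [ffun => 0]).
(** The pair [a] stands for the map sending [(i, z)] to [(a.1 i, z + a.2 i)]; the product is
    composition from left to right, as for permutations. *)
Definition wreath_mul (a b : wreath) : wreath :=
  ((a.1 * b.1)%g, [ffun i => a.2 i + b.2 (a.1 i)]).
Definition wreath_inv (a : wreath) : wreath :=
  ((a.1^-1)%g, [ffun i => - a.2 ((a.1^-1)%g i)]).

Lemma wreath_mulA : associative wreath_mul.
Proof.
move=> a b c; congr pair; first exact: mulgA.
by apply/ffunP=> i; rewrite !ffunE permM addrA.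
Qed.

Lemma wreath_mul1 : left_id wreath_one wreath_mul.
Proof.
move=> [s u]; congr pair; first exact: mul1g.
by apply/ffunP=> i; rewrite !ffunE perm1 add0r.
Qed.

Lemma wreath_mulr1 : right_id wreath_one wreath_mul.
Proof.
move=> [s u]; congr pair; first exact: mulg1.
by apply/ffunP=> i; rewrite !ffunE addr0.
Qed.

Lemma wreath_mulV : left_inverse wreath_one wreath_inv wreath_mul.
Proof.
move=> [s u]; congr pair; first exact: mulVg.
by apply/ffunP=> i; rewrite !ffunE addNr.
Qed.

Lemma wreath_mulrV : right_inverse wreath_one wreath_inv wreath_mul.
Proof.
move=> [s u]; congr pair; first exact: mulgV.
by apply/ffunP=> i; rewrite !ffunE permK addrN.
Qed.

HB.instance Definition _ := isGroup.Build wreath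
  wreath_mulA wreath_mul1 wreath_mulr1 wreath_mulV wreath_mulrV.

Definition wreath_box (L : nat) : {fset wreath} :=
  [fset a in codom (fun p : {perm 'I_n} * {ffun 'I_n -> 'I_L.+1} =>
    (p.1, [ffun i => (p.2 i)%:Z]) : wreath)]%fset.

Lemma wreath_boxP L (a : wreath) :
  reflect (forall i, 0 <= a.2 i <= L%:Z) (a \in wreath_box L).
Proof.
rewrite in_fset; apply: (iffP codomP) => [[[s f] ->] i|].
  by rewrite ffunE /= lez_nat -ltnS ltn_ord.
case: a => s u /= u_le; exists (s, [ffun i => inord `|u i|%N]); congr pair.
apply/ffunP=> i; rewrite !ffunE; have /andP[u0 uL] := u_le i.
by rewrite inordK ?gez0_abs // ltnS -lez_nat gez0_abs.
Qed.

Definition wreath_corners (L : nat) : {fset wreath} :=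
  [fset a in codom (fun f : {ffun 'I_n -> bool} =>
    (1%g, [ffun i => if f i then L%:Z else 0]) : wreath)]%fset.

Lemma card_wreath_corners L : (#|` wreath_corners L| <= 2 ^ n)%N.
Proof.
rewrite card_fseq; apply: leq_trans (size_undup _) _.
by rewrite size_codom card_ffun card_bool card_ord.
Qed.

Lemma approximate_wreath_box (R : realType) L :
  approximate_group (2 ^+ n : R) [set` wreath_box L].
Proof.
exists (wreath_corners L); split.
  by rewrite -natrX ler_nat card_wreath_corners.
move=> _ [a /wreath_boxP aL] [b /wreath_boxP bL] <-.
(* Coordinates of [a * b] lie between [0] and [2 L]; those above [L] are lowered by [L]. A corner
   has trivial permutation part, so multiplying by it on the left adds coordinatewise. *)
exists (1%g, [ffun i => if L%:Z < (a * b)%g.2 i then L%:Z else 0]).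
  rewrite /= in_fset; apply/codomP; exists [ffun i => L%:Z < (a * b)%g.2 i].
  by congr pair; apply/ffunP=> i; rewrite !ffunE.
exists ((a * b)%g.1, [ffun i => (a * b)%g.2 i -
    if L%:Z < (a * b)%g.2 i then L%:Z else 0]).
  apply/wreath_boxP => i; rewrite !ffunE.
  by have := aL i; have := bL (a.1 i); case: ifP; lia.
apply/eqP; rewrite -pair_eqE; apply/andP; split; first by rewrite /= mul1g.
by apply/eqP/ffunP=> i; rewrite !ffunE /= perm1; lia.
Qed.

Definition shift i (z : int) : wreath :=
  (1%g, [ffun j => if j == i then z else 0]).

Lemma shiftM i y z : (shift i y * shift i z)%g = shift i (y + z).
Proof.
congr pair; first exact: mulg1.
by apply/ffunP=> j; rewrite !ffunE /= perm1; case: ifP; rewrite ?addr0.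
Qed.

Lemma shiftV i z : (shift i z)^-1%g = shift i (- z).
Proof.
congr pair; first exact: invg1.
by apply/ffunP=> j; rewrite !ffunE /= invg1 perm1; case: ifP; rewrite ?oppr0.
Qed.

(** The right factor adds [z] at the coordinate that [h.1] sends to [i], which is not [i], so it
    does not cancel the [- z] of the left factor. *)
Lemma conj_shift_eval i (h : wreath) z : h.1 i != i ->
  (h ^ shift i z)%g.2 i = h.2 i - z.
Proof.
move=> /negPf hi; rewrite /conjg shiftV.
by rewrite !ffunE /= eqxx perm1 hi addr0 addrC.
Qed.

(** * Subgroups that cover the box by few cosets *)

Section SolvableByFinite.
Local Open Scope classical_set_scope.
Local Open Scope group_scope.
Variables (Gamma : subgroup wreath) (L : nat).
Hypothesis few_cosets : (#|` left_cosets (wreath_box L) Gamma| <= L)%N.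

(** Pigeonhole: the [L + 1] shifts by [0, ..., L] lie in the box, so two of them share a coset and
    their quotient lies in [Gamma]. *)
Lemma shift_in_subgroup i :
  exists m : nat, (0 < m)%N /\ subgroup_set Gamma (shift i m%:Z).
Proof.
pose f (k : 'I_L.+1) := left_coset Gamma (shift i k%:Z).
have [/injectiveP inj|/injectivePn[k [l kl fkl]]] := boolP (injectiveb f).
  suff: (L.+1 <= L)%N by rewrite ltnn.
  apply: leq_trans few_cosets.
  rewrite -[L.+1]card_ord cardE -(size_map f); apply: uniq_leq_size.
    by rewrite map_inj_uniq ?enum_uniq.
  move=> _ /mapP[k _ ->]; apply/imfsetP; exists (shift i k%:Z) => //=.
  apply/wreath_boxP => j; rewrite ffunE; case: ifP => //= _.
  by rewrite lez_nat -ltnS ltn_ord.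
wlog ltkl : k l kl fkl / (k < l)%N.
  move=> wl; case: (ltngtP k l) => [lt|lt|/val_inj/eqP].
  - exact: wl kl fkl lt.
  - by apply: wl (esym fkl) lt; rewrite eq_sym.
  - by rewrite (negPf kl).
exists (l - k)%N; rewrite subn_gt0; split=> //.
have : f l (shift i l%:Z).
  by exists 1%g; [apply: subgroup1 | rewrite mulg1].
rewrite -fkl => -[g Gg /(canRL (mulKg _)) gE]; rewrite gE in Gg.
by rewrite -subzn 1?ltnW // addrC -shiftM -shiftV.
Qed.

Lemma finite_normal_trivial_perm (H : normal_subgroup (subgroup_type Gamma)) h :
  finite_set (subgroup_set H) -> subgroup_set H h -> (\val h).1 = 1.
Proof.
move=> finH Hh; apply/permP => i; rewrite perm1; apply/eqP/negPn/negP => hi.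
have [m [m0 Gm]] := shift_in_subgroup i.
have Gk k : (shift i (k * m)%N%:Z) \in (subgroup_set Gamma : set wreath).
  apply/mem_set; elim: k => [|k IHk]; last first.
    by rewrite mulSn PoszD -shiftM; apply: subgroupM.
  rewrite (_ : shift i _ = 1); first exact: subgroup1.
  by congr pair; apply/ffunP=> j; rewrite !ffunE mul0n if_same.
pose t k : subgroup_type Gamma :=
  exist (fun x : wreath => x \in subgroup_set Gamma) _ (Gk k).
(* If [h] moved [i], its conjugates by the shifts by multiples of [m] would be pairwise distinct,
   and all of them lie in the finite [H]. *)
have inj : injective (fun k => h ^ t k).
  move=> k l hkl.
  have vE j : (\val (h ^ t j)).2 i = ((\val h).2 i - (j * m)%N%:Z)%R.
    exact: conj_shift_eval.
  have := vE k; rewrite hkl vE => /addrI/oppr_inj[] /eqP.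
  by rewrite eqn_pmul2r // => /eqP.
apply: infinite_nat; have := finite_preimage (in2W inj) finH.
congr finite_set; apply/seteqP; split=> // k _ /=.
exact: normal_subP.
Qed.

Definition perm_image :=
  [set s | `[< exists u, subgroup_set Gamma ((s, u) : wreath) >]]%SET.

Lemma perm_imageP s :
  reflect (exists u, subgroup_set Gamma ((s, u) : wreath)) (s \in perm_image).
Proof. by rewrite inE; apply: asboolP. Qed.

Lemma perm_image_group_set : group_set perm_image.
Proof.
apply/group_setP; split=> [|s t /perm_imageP[u Gu] /perm_imageP[v Gv]].
  by apply/perm_imageP; eexists; apply: (subgroup1 Gamma).
by apply/perm_imageP; eexists; apply: (subgroupM Gu Gv).
Qed.
Canonical perm_image_group := Group perm_image_group_set.

Definition perm_part (g : subgroup_type Gamma) : {perm 'I_n} := (\val g).1.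

Lemma perm_partF : {morph perm_part : g h / g * h^-1}.
Proof. by []. Qed.

HB.instance Definition _ :=
  isGroupMorphism.Build (subgroup_type Gamma) {perm 'I_n} perm_part perm_partF.

(** An element of the [k]-th derived subgroup of the image lifts to an element of [Gamma] that is
    trivial modulo [H]; the lift lies in [H], hence has trivial permutation part. *)
Lemma solvable_perm_image (H : normal_subgroup (subgroup_type Gamma)) :
  finite_set (subgroup_set H) -> solvable_group (quotient_group H) ->
  solvable perm_image.
Proof.
move=> finH [k dk]; apply/derivedP; exists k; apply/trivgP/fintype.subsetP => s.
move=> /(derived_series_lift (f := perm_part) (@quotient_proj _ H)) [].
  move=> t /perm_imageP[u Gu].
  by exists (exist (fun x : wreath => x \in subgroup_set Gamma) _ (mem_set Gu)).
move=> g [<-]; rewrite dk /= -(gmulf1 (s := @quotient_proj _ H)).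
move=> /esym/quotient_proj_eq; rewrite invg1 mul1g => Hg.
by rewrite inE; apply/eqP/(finite_normal_trivial_perm finH Hg).
Qed.

(** The box contains every [(s, 0)], and the permutation parts of the coset of [(s, 0)] form the
    coset of [s] modulo [perm_image]. So the index of [perm_image] is at most the number of cosets
    of [Gamma] met by the box. *)
Lemma fact_le_cosets :
  (n`! <= #|` left_cosets (wreath_box L) Gamma| * #|perm_image|)%N.
Proof.
have -> : n`! = #|[set: {perm 'I_n}]%SET| by rewrite cardsT card_Sn.
rewrite -(Lagrange (finset.subsetT perm_image_group)) /= mulnC leq_mul2r.
apply/orP; right; rewrite -card_lcosets cardE.
pose F (C : set wreath) := [set s | `[< exists u, C ((s, u) : wreath) >]]%SET.
rewrite -(size_map F); apply: uniq_leq_size; first exact: enum_uniq.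
move=> C; rewrite mem_enum => /lcosetsP[s _ ->].
apply/mapP; exists (left_coset Gamma ((s, 0%R) : wreath)).
  apply/imfsetP; exists (s, 0%R) => //=.
  by apply/wreath_boxP => i; rewrite ffunE.
apply/setP=> t; rewrite mem_lcoset [RHS]inE.
apply/perm_imageP/asboolP => -[u Gu]; last first.
  case: Gu => -[r v] Gr [<- _]; exists v; rewrite /= mulKg.
  exact: Gr.
eexists; exists ((s^-1 * t, u) : wreath); first exact: Gu.
by congr pair; rewrite /= mulKVg.
Qed.

End SolvableByFinite.

End Wreath.

(** * Estimates for factorials and logarithms *)

Lemma fact_add_lower m k : (m`! * m ^ k <= (m + k)`!)%N.
Proof.
elim: k => [|k IHk]; first by rewrite expn0 muln1 addn0.
by rewrite addnS factS expnSr mulnA mulnC leq_mul // leqW ?leq_addr.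
Qed.

(** A weak Stirling bound; powers of two allow induction by doubling, where each of the [m] new
    factors of the factorial is at least [m]. *)
Lemma pow2_self_exp_le_fact t (n := (2 ^ t)%N) : (n ^ n <= 4 ^ n * n`!)%N.
Proof.
elim: t @n => [//|t]; rewrite /= expnS mul2n -addnn; set m := (2 ^ t)%N => IHm.
have -> : ((m + m) ^ (m + m) = 4 ^ m * m ^ m * m ^ m)%N.
  by rewrite -mulnA -expnD addnn -mul2n expnMn [(2 ^ (2 * m))%N]expnM.
apply: leq_trans (leq_mul (leqnn _) (fact_add_lower m m)).
by rewrite expnD !mulnA leq_mul2r -mulnA leq_mul2l IHm !orbT.
Qed.

Section Estimates.
Local Open Scope ring_scope.
Variable R : realType.

(** [expR (4 / 5)] is at least [(6 / 5)^4 = 1296 / 625], which exceeds [2]. *)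
Lemma ln2_le : ln 2 <= 4 / 5 :> R.
Proof.
rewrite -[leRHS]expRK ler_ln ?posrE ?expR_gt0 //.
have e5 : 6 / 5 <= expR (1 / 5) :> R.
  by apply: le_trans (expR_ge1Dx _); lra.
have -> : 4 / 5 = 4%:R * (1 / 5) :> R by lra.
rewrite expRM_natl; apply: (@le_trans _ _ ((6 / 5) ^+ 4)); first by lra.
by apply: lerXn2r e5; rewrite ?nnegrE ?expR_ge0 //; lra.
Qed.

(** For [K = 2 ^ n] one has [ln (ln K) <= ln n = 5 j ln 2 <= 4 j]; the factor [5] in the exponent of
    [n] keeps this bound integral. *)
Lemma powR_lnln_le j (n := (2 ^ (5 * j))%N) : (0 < j)%N ->
  (2 ^+ n : R) `^ ln (ln (2 ^+ n)) <= (2 ^ (4 * j * n))%:R.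
Proof.
move=> j0.
have ln2_gt0 : 0 < ln 2 :> R by apply: ln_gt0; lra.
have lnKn : ln (2 ^+ n) = n%:R * ln 2 :> R by rewrite lnXn // mulr_natl.
have n_gt0 : 0 < n%:R :> R by rewrite ltr0n expn_gt0.
have j_ge0 : 0 <= j%:R :> R by apply: ler0n.
have lnlnK : ln (ln (2 ^+ n)) <= 4 * j%:R :> R.
  rewrite lnKn; apply: (@le_trans _ _ (ln n%:R)).
    rewrite ler_ln ?posrE ?mulr_gt0 // ger_pMr //.
    by apply: le_trans ln2_le _; lra.
  rewrite natrX lnXn // -[ln 2 *+ _]mulr_natl natrM.
  by have := ler_wpM2l j_ge0 ln2_le; lra.
rewrite /powR gt_eqF ?exprn_gt0 // natrX -[X in _ <= X ^+ _]lnK ?posrE //.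
rewrite -expRM_natl ler_expR lnKn !natrM -mulrA ler_wpM2r //.
  by rewrite mulr_ge0 // ltW.
by rewrite -lnKn.
Qed.

End Estimates.

(** * Choice of parameters and contradiction *)

Local Open Scope classical_set_scope.
Local Open Scope ring_scope.

Theorem theorem1p4 (R : realType) :
  forall K0 : R, exists K : R, K0 <= K /\
  exists (G : groupType) (A : {fset G}),
    approximate_group K [set` A] /\
    ~ exists (Gamma : subgroup G),
        (exists H : normal_subgroup (subgroup_type Gamma),
           finite_set (subgroup_set H) /\ solvable_group (quotient_group H)) /\
        #|` left_cosets A Gamma|%:R <= K `^ ln (ln K).
Proof.
(* The [6] serves the final comparison of exponents; the other entry gives
   [K0 <= j <= n <= 2 ^ n]. *)
move=> K0; pose j := maxn 6 (Num.bound `|K0|).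
(* [L], set just below, is both the side of the box and the upper bound for [K] to the power
   [ln (ln K)], as the pigeonhole argument requires. *)
have j6 : (6 <= j)%N by apply: leq_maxl.
pose n := (2 ^ (5 * j))%N; pose L := (2 ^ (4 * j * n))%N.
have jn : (j <= n)%N.
  by rewrite ltnW // (leq_ltn_trans _ (ltn_expl _ _)) // leq_pmull.
exists (2 ^+ n); split.
  apply: le_trans (ler_norm _) _; apply/ltW.
  apply: lt_le_trans (archi_boundP (normr_ge0 K0)) _.
  rewrite -natrX ler_nat; apply: leq_trans (leq_maxr 6 _) _.
  by apply: leq_trans jn _; rewrite ltnW // ltn_expl.
exists (wreath n), (wreath_box n L); split; first exact: approximate_wreath_box.
move=> [Gamma [[H [finH solH]] cosets_le]].
have {}cosets_le : (#|` left_cosets (wreath_box n L) Gamma| <= L)%N.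
  rewrite -(ler_nat R); apply: le_trans cosets_le _.
  by rewrite powR_lnln_le // (leq_trans _ j6).
have fact_le := fact_le_cosets Gamma L.
have P_le := solvable_perm_card (solvable_perm_image cosets_le finH solH).
have n0 : (0 < n)%N by rewrite expn_gt0.
(* Comparing exponents gives [j n <= 6 n - 4], against [6 <= j]. The left side is [n ^ n]; on the
   right, [2 n] comes from [4 ^ n], [4 j n] from [L], and [4 (n - 1)] from the order of the solvable
   image. *)
suff : (2 ^ (5 * j * n) <= 2 ^ (2 * n + (4 * j * n + 4 * n.-1)))%N.
  rewrite leq_exp2l //; move: n0 (leq_mul j6 (leqnn n)); clear.
  by move: n => n; lia.
apply: (@leq_trans (4 ^ n * (L * 16 ^ n.-1))%N).
  have /= n_le := pow2_self_exp_le_fact (5 * j); rewrite -/n in n_le.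
  rewrite [leqLHS](_ : _ = n ^ n)%N; last by rewrite expnM.
  apply: leq_trans n_le _; rewrite leq_mul2l.
  apply/orP; right; apply: leq_trans fact_le _.
  exact: leq_mul cosets_le P_le.
by rewrite 2!expnD [(2 ^ (2 * n))%N]expnM [(2 ^ (4 * n.-1))%N]expnM.
Qed.
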